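(* Let $X_1,\dots,X_n$ be random variables whose joint cdf is absolutely continuous with respect to the product of their one-dimensional marginal cdf's, and let $\xi_1,\dots,\xi_n$ be independent random variables such that $\xi_k$ has the same distribution as $X_k$, $k=1,\dots,n$. If $f:\mathbf R^n\to\mathbf R$ is a nonnegative (Borel measurable) function, then the following inequalities hold: $$Ef(X_1,\dots,X_n)\le Ef(\xi_1,\dots,\xi_n)+\phi_{X_1,\dots,X_n}\big(Ef^2(\xi_1,\dots,\xi_n)\big)^{1/2},$$ $$Ef(X_1,\dots,X_n)\le\big(1+\phi^2_{X_1,\dots,X_n}\big)^{1/q}\big(Ef^q(\xi_1,\dots,\xi_n)\big)^{1/q},\quad q\ge2,$$ $$Ef(X_1,\dots,X_n)\le E\exp(f(\xi_1,\dots,\xi_n))-1+\delta_{X_1,\dots,X_n},$$ $$Ef(X_1,\dots,X_n)\le\big(1+D^\psi_{X_1,\dots,X_n}\big)^{1-\frac1q}\big(Ef^q(\xi_1,\dots,\xi_n)\big)^{1/q},\quad q>1,$$ where in the last inequality $\psi(x)=|x|^{q/(q-1)}-1$. These inequalities are sharp, in the sense that for each of them there exist random variables $X_1,\dots,X_n$ whose joint cdf is absolutely continuous with respect to the product of their one-dimensional marginal cdf's and a nonnegative Borel measurable function $f:\mathbf R^n\to\mathbf R$ for which equality holds.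
   Context: Let $F$ be the joint cdf and $F_1,\dots,F_n$ the marginal cdf's of $X_1,\dots,X_n$, and let $G=\frac{dF}{dF_1\cdots dF_n}\ge0$ be the density of the joint distribution with respect to the product of marginals (taken to be $1$ outside the support of $dF_1\cdots dF_n$). Define the multivariate Pearson coefficient $\phi^2_{X_1,\dots,X_n}=\int_{\mathbf R^n}G^2\prod_{i=1}^ndF_i-1$, $\phi_{X_1,\dots,X_n}=(\phi^2_{X_1,\dots,X_n})^{1/2}$; the relative entropy $\delta_{X_1,\dots,X_n}=\int_{\mathbf R^n}\log(G)\,dF$; and the multivariate divergence measure $D^\psi_{X_1,\dots,X_n}=\int_{\mathbf R^n}\psi(G)\prod_{i=1}^ndF_i$. All quantities may be $+\infty$, with the convention $0\cdot\infty=0$. *)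

(* Defs.v *)
From HB Require Import structures.
From mathcomp Require Import all_boot all_order all_algebra.
From mathcomp Require Import all_classical all_reals all_analysis.

Set Implicit Arguments.
Unset Strict Implicit.
Unset Printing Implicit Defensive.

Import Order.TTheory GRing.Theory Num.Theory.
Import numFieldNormedType.Exports.

Local Open Scope classical_set_scope.
Local Open Scope ring_scope.
Local Open Scope ereal_scope.

(* R^n is [n.-tuple R] with the sigma-algebra generated by the coordinates,
   which is the Borel one. The Lebesgue-Stieltjes measures dF and dF_i of the
   cdf's are the laws [distribution P _] of the vector and of the X_i. *)

Definition tuple_cons (R : realType) (n : nat) (x : R * n.-tuple R) :
  n.+1.-tuple R := [tuple of x.1 :: x.2].

Lemma measurable_tuple_cons (R : realType) (n : nat) :
  measurable_fun [set: R * n.-tuple R] (@tuple_cons R n).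
Proof. exact: measurable_cons. Qed.

HB.instance Definition _ (R : realType) (n : nat) :=
  isMeasurableFun.Build _ _ _ _ (@tuple_cons R n) (@measurable_tuple_cons R n).

(* mu_0 x ... x mu_(n-1): the library only has binary products. *)
Fixpoint prod_probability (R : realType) (n : nat) :
    ('I_n -> probability R R) -> probability (n.-tuple R) R :=
  match n with
  | 0 => fun _ => \d_([tuple] : 0.-tuple R)
  | n'.+1 => fun mu =>
      distribution
        (mu ord0 \x prod_probability (fun i => mu (lift ord0 i)) :
           probability (R * n'.-tuple R)%type R)
        (@tuple_cons R n')
  end.

(* Balls for the sup distance form a base of the topology of R^n. *)
Definition measure_support (R : realType) (n : nat)
    (mu : probability (n.-tuple R) R) : set (n.-tuple R) :=
  [set x | forall e : R, (0 < e)%R ->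
    0 < mu [set y | forall i, (`|tnth x i - tnth y i| < e)%R]].

Section dependence.
Context d (T : measurableType d) (R : realType) (P : probability T R).
Context (n : nat) (X : 'I_n -> {RV P >-> R}).

Definition random_vector (w : T) : n.-tuple R := [tuple X i w | i < n].

Lemma measurable_random_vector : measurable_fun [set: T] random_vector.
Proof.
apply/measurable_fun_tnthP => i.
rewrite (_ : _ \o _ = X i); first exact: measurable_funPT.
by apply/funext => w /=; rewrite tnth_mktuple.
Qed.

HB.instance Definition _ :=
  isMeasurableFun.Build _ _ _ _ random_vector measurable_random_vector.

Definition joint_law : probability (n.-tuple R) R := distribution P random_vector.

Definition marginal_law (i : 'I_n) : probability R R := distribution P (X i).

Definition product_law : probability (n.-tuple R) R :=
  prod_probability marginal_law.

(* [Radon_Nikodym_SigmaFinite.f] is an everywhere nonnegative and finite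
   version of the derivative (lemmas [f_ge0] and [f_fin_num] there), provided
   joint_law `<< product_law. *)
Definition dependence_density (x : n.-tuple R) : R :=
  if x \in measure_support product_law
  then fine (Radon_Nikodym_SigmaFinite.f joint_law product_law x)
  else 1%R.

Local Notation G := dependence_density.

Definition pearson2 : \bar R := (\int[product_law]_x (G x ^+ 2)%:E) - 1.

Definition pearson : \bar R := pearson2 `^ 2^-1.

(* [ln 0 = 0] in the library; [G] vanishes only on a [joint_law]-null set. *)
Definition relative_entropy : \bar R := \int[joint_law]_x (ln (G x))%:E.

Definition divergence (psi : R -> R) : \bar R :=
  \int[product_law]_x (psi (G x))%:E.

Definition mutually_independent : Prop :=
  forall (J : {set 'I_n}) (A : 'I_n -> set R),
    (forall i, i \in J -> measurable (A i)) ->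
    P (\bigcap_(i in [set` J]) (X i @^-1` A i)) =
    \prod_(i in J) P (X i @^-1` A i).

End dependence.

(* Distributions are compared on Borel sets only: a library measure also takes
   values, of no significance, on nonmeasurable sets. *)
Definition same_marginals (R : realType) (n : nat)
    (d : measure_display) (T : measurableType d) (P : probability T R)
    (X : 'I_n -> {RV P >-> R})
    (d' : measure_display) (T' : measurableType d') (P' : probability T' R)
    (xi : 'I_n -> {RV P' >-> R}) : Prop :=
  forall k (A : set R), measurable A ->
    distribution P' (xi k) A = distribution P (X k) A.

Definition decoupling_setting (R : realType) (n : nat)
    (d : measure_display) (T : measurableType d) (P : probability T R)
    (X : 'I_n -> {RV P >-> R})
    (d' : measure_display) (T' : measurableType d') (P' : probability T' R)
    (xi : 'I_n -> {RV P' >-> R}) (f : n.-tuple R -> R) : Prop :=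
  [/\ joint_law X `<< product_law X,
      mutually_independent xi,
      same_marginals X xi,
      measurable_fun [set: n.-tuple R] f
    & forall x, (0 <= f x)%R].

(* Main.v *)
(** Write [mu] for the product of the marginals, [nu] for the joint law and
    [G = d nu / d mu], so that [E f(X) = \int f G d mu].
    - First inequality: [f G <= f + f |G - 1|], then Cauchy-Schwarz, because
      [\int (G - 1)^2 d mu = \int G^2 d mu - 1].
    - Fourth: Hoelder with the conjugate exponent [q' = q / (q - 1)] on [G].
    - Second: [q' = 1 + t] with [0 < t <= 1], and [\int G^(1 + t) d mu] is at
      most [(\int G^2 d mu)^t], by integrating [G] times the tangent line of
      the concave function [z |-> z^t] at [z = \int G^2 d mu].
    - Third: integrate Young's inequality [a b <= e^a - b + b ln b].
    Equality holds in each of them for constant [X] and [f = 0]. *)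

Require Import Defs.
From HB Require Import structures.
From mathcomp Require Import all_boot all_order all_algebra.
From mathcomp Require Import all_classical all_reals all_analysis.
From mathcomp Require Import measurable_realfun ring lra.

Set Implicit Arguments.
Unset Strict Implicit.
Unset Printing Implicit Defensive.

Import Order.TTheory GRing.Theory Num.Theory.
Import numFieldNormedType.Exports.

Local Open Scope classical_set_scope.
Local Open Scope ring_scope.
Local Open Scope ereal_scope.

(** * Pointwise inequalities on the real line *)

(* Also true for [b = 0], where the library's [ln 0 = 0] is multiplied by 0. *)
Lemma mulr_le_expR (R : realType) (a b : R) : (0 <= b)%R ->
  (a * b <= expR a - b + b * ln b)%R.
Proof.
rewrite le_eqVlt => /predU1P[<-|b0].
  by rewrite mulr0 mul0r subr0 addr0 expR_ge0.
have : (b * (1 + (a - ln b)) <= b * expR (a - ln b))%R.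
  by rewrite ler_pM2l// expR_ge1Dx.
by rewrite expRB lnK ?posrE// mulrCA divff ?gt_eqF// mulr1; lra.
Qed.

(** Young's inequality with exponents [1 / t] and [1 / (1 - t)], applied to two factors whose
    product is [a ^ t] because the powers of [m] cancel. At [t = 1] the second exponent degenerates,
    so that case is treated apart. *)
Lemma powR_le_tangent (R : realType) (a m t : R) : (0 <= a)%R -> (0 < m)%R ->
  (0 < t <= 1)%R -> (a `^ t <= t * m `^ (t - 1) * a + (1 - t) * m `^ t)%R.
Proof.
move=> a0 m0 /andP[t0]; rewrite le_eqVlt => /predU1P[->|t1].
  by rewrite subrr powRr0 powRr1// !mul1r mul0r addr0.
have t1' : (0 < 1 - t)%R by rewrite subr_gt0.
have := @conjugate_powR R ((m `^ (t - 1) * a) `^ t) (m `^ (t * (1 - t)))%R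
   t^-1%R (1 - t)^-1%R (powR_ge0 _ _) (powR_ge0 _ _).
rewrite !invr_gt0 !invrK => /(_ t0 t1'); rewrite subrKC => /(_ erefl).
rewrite -!powRrM mulfV ?gt_eqF// powRr1 ?mulr_ge0 ?powR_ge0//.
rewrite mulfK ?gt_eqF// powRM ?powR_ge0// -powRrM mulrAC -powRD; last first.
  by rewrite (gt_eqF m0) implybT.
have -> : ((t - 1) * t + t * (1 - t) = 0)%R by ring.
rewrite powRr0 mul1r => /le_trans; apply.
by rewrite mulrC mulrA (mulrC (m `^ t)%R).
Qed.

(** * Integrals of real-valued functions, possibly infinite *)

Lemma ge0_hoelder d (T : measurableType d) (R : realType)
    (mu : {measure set T -> \bar R}) (f g : T -> R) (p q : R) :
  measurable_fun [set: T] f -> measurable_fun [set: T] g ->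
  (forall x, 0 <= f x)%R -> (forall x, 0 <= g x)%R ->
  (0 < p)%R -> (0 < q)%R -> (p^-1 + q^-1 = 1)%R ->
  \int[mu]_x (f x * g x)%:E <=
    (\int[mu]_x (f x `^ p)%:E) `^ p^-1 * (\int[mu]_x (g x `^ q)%:E) `^ q^-1.
Proof.
move=> mf mg f0 g0 p0 q0 pq; have := hoelder mu mf mg p0 q0 pq.
rewrite Lnorm1 unlock => h.
apply: (le_trans (le_trans _ h)).
  rewrite le_eqVlt; apply/orP; left; apply/eqP; apply: eq_integral => x _.
  by rewrite /= ger0_norm// mulr_ge0.
rewrite le_eqVlt; apply/orP; left; apply/eqP.
have normE (u : T -> R) r : (forall x, 0 <= u x)%R ->
    \int[mu]_x (`|(EFin \o u) x| `^ r) = \int[mu]_x (u x `^ r)%:E.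
  by move=> u0; apply: eq_integral => x _; rewrite /= ger0_norm.
apply: f_equal2.
  apply: (f_equal (poweR^~ p^-1%R)).
  exact: (normE f).
apply: (f_equal (poweR^~ q^-1%R)).
exact: (normE g).
Qed.

Lemma ge0_integral_EFinD d (T : measurableType d) (R : realType)
    (mu : {measure set T -> \bar R}) (f g : T -> R) :
  measurable_fun [set: T] f -> measurable_fun [set: T] g ->
  (forall x, 0 <= f x)%R -> (forall x, 0 <= g x)%R ->
  \int[mu]_x (f x + g x)%:E = \int[mu]_x (f x)%:E + \int[mu]_x (g x)%:E.
Proof.
move=> mf mg f0 g0; rewrite -ge0_integralD//.
all: by [move=> x _; rewrite lee_fin|exact/measurable_EFinP].
Qed.

Lemma ge0_le_integral_EFin d (T : measurableType d) (R : realType)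
    (mu : {measure set T -> \bar R}) (f g : T -> R) :
  measurable_fun [set: T] f -> measurable_fun [set: T] g ->
  (forall x, 0 <= f x)%R -> (forall x, f x <= g x)%R ->
  \int[mu]_x (f x)%:E <= \int[mu]_x (g x)%:E.
Proof.
move=> mf mg f0 fg; apply: ge0_le_integral => //.
all: by [move=> x _; rewrite lee_fin|exact/measurable_EFinP
  |move=> x _; rewrite lee_fin (le_trans _ (fg x))].
Qed.

Lemma integral_probability_cst1 d (T : measurableType d) (R : realType)
  (P : probability T R) : \int[P]_x (1 : \bar R) = 1.
Proof. by rewrite integral_cst// mul1e; exact: probability_setT. Qed.

Lemma integral_EFin_maxr d (T : measurableType d) (R : realType)
    (mu : {measure set T -> \bar R}) (f : T -> R) :
  \int[mu]_x (f x)%:E =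
  \int[mu]_x (Num.max (f x) 0%R)%:E - \int[mu]_x (Num.max (- f x)%R 0%R)%:E.
Proof.
rewrite integralE; congr (_ - _); apply: eq_integral => x _.
  by rewrite funeposE /= EFin_max.
by rewrite funenegE /= EFin_max.
Qed.

(** Since [h] is nonnegative, the negative part of [h - 1] is at most 1 and has a finite integral.
    This lets the constant be split off even when the integral of [h] is infinite. *)
Lemma add1_integralB1 d (T : measurableType d) (R : realType)
    (P : probability T R) (h : T -> R) :
  measurable_fun [set: T] h -> (forall x, 0 <= h x)%R ->
  1 + \int[P]_x (h x - 1)%:E = \int[P]_x (h x)%:E.
Proof.
move=> mh h0; rewrite integral_EFin_maxr.
pose p x : R := Num.max (h x - 1)%R 0%R.
pose m x : R := Num.max (- (h x - 1))%R 0%R.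
rewrite -/p -/m.
have mp : measurable_fun [set: T] p.
  by apply: measurable_maxr => //; exact: measurable_funB.
have mm : measurable_fun [set: T] m.
  apply: measurable_maxr => //; apply: measurableT_comp => //.
  exact: measurable_funB.
have p0 x : (0 <= p x)%R by rewrite le_max lexx orbT.
have m0 x : (0 <= m x)%R by rewrite le_max lexx orbT.
have m1 : \int[P]_x (m x)%:E <= 1.
  rewrite -(integral_probability_cst1 P); apply: ge0_le_integral_EFin => // x.
  by rewrite ge_max ler01 andbT; have := h0 x; lra.
have mfin : \int[P]_x (m x)%:E \is a fin_num.
  rewrite ge0_fin_numE ?(le_lt_trans m1) ?ltry//; apply: integral_ge0 => x _.
  by rewrite lee_fin.
(* Integrates [1 + p = h + m], an identity between nonnegative functions; only the finite integral
   of [m] is then subtracted. *)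
have E : 1 + \int[P]_x (p x)%:E = \int[P]_x (h x)%:E + \int[P]_x (m x)%:E.
  rewrite -(integral_probability_cst1 P) -!ge0_integral_EFinD//.
  apply: eq_integral => x _; congr (_%:E); rewrite /p /m.
  by case: (leP (h x - 1) 0)%R => ?; case: (leP (- (h x - 1)) 0)%R => ?; lra.
by rewrite addeA E addeK.
Qed.

(** * The four inequalities for an abstract density [G] of [nu] with respect to [mu] *)

Section change_of_measure.
Context d (T : measurableType d) (R : realType) (mu nu : probability T R).
Context (G : T -> R) (mG : measurable_fun [set: T] G).
Context (G0 : forall x, (0 <= G x)%R).
Context (nuE : forall h : T -> \bar R, measurable_fun [set: T] h ->
  (forall x, 0 <= h x) -> \int[nu]_x h x = \int[mu]_x (h x * (G x)%:E)).
Implicit Types f : T -> R.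

Lemma integral_density : \int[mu]_x (G x)%:E = 1.
Proof.
have := nuE (@measurable_cst _ _ T _ [set: T] (1 : \bar R)) (fun=> lee01).
rewrite integral_probability_cst1 => ->.
by apply: eq_integral => x _; rewrite mul1e.
Qed.

Lemma ge0_integral_EFin_density f : measurable_fun [set: T] f ->
  (forall x, 0 <= f x)%R ->
  \int[nu]_x (f x)%:E = \int[mu]_x (f x * G x)%:E.
Proof. by move=> mf f0; rewrite nuE//; exact/measurable_EFinP. Qed.

(** Integrate [G^2 + 1 = (G - 1)^2 + 2 G], where every term is nonnegative, so that an infinite
    second moment is allowed; the integral of [G] is 1. The form [|G - 1| ^ 2] is the one that
    Hoelder's inequality produces. *)
Lemma integral_sqr_density :
  \int[mu]_x (G x ^+ 2)%:E = 1 + \int[mu]_x (`|G x - 1| `^ 2)%:E.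
Proof.
have mH : measurable_fun [set: T] (fun x => `|G x - 1| `^ 2)%R.
  apply: (@measurableT_comp _ _ _ _ _ _ (fun t : R => t `^ 2)%R) => //.
  by apply: measurableT_comp => //; exact: measurable_funB.
have m2 : measurable_fun [set: T] (fun x => G x ^+ 2)%R.
  exact: measurable_funX.
have H0 x : (0 <= `|G x - 1| `^ 2)%R by exact: powR_ge0.
have E : \int[mu]_x (G x ^+ 2 + 1)%:E
       = \int[mu]_x (`|G x - 1| `^ 2 + (G x + G x))%:E.
  apply: eq_integral => x _; rewrite powR_mulrn// real_normK ?num_real//.
  by congr (_%:E); ring.
move: E; rewrite (@ge0_integral_EFinD _ _ _ mu _ (fun=> 1%R))//; last first.
  by move=> x; exact: sqr_ge0.
rewrite integral_probability_cst1.
rewrite (@ge0_integral_EFinD _ _ _ mu _ (fun x => G x + G x)%R)//; last 2 first.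
- exact: measurable_funD.
- by move=> x; exact: addr_ge0.
rewrite ge0_integral_EFinD// integral_density addeA.
by move/(congr1 (fun z => z - 1)); rewrite !addeK// addeC.
Qed.

Lemma pearson_inequality f : measurable_fun [set: T] f ->
  (forall x, 0 <= f x)%R ->
  \int[nu]_x (f x)%:E <= \int[mu]_x (f x)%:E +
    (\int[mu]_x (G x ^+ 2)%:E - 1) `^ 2^-1 * (\int[mu]_x (f x ^+ 2)%:E) `^ 2^-1.
Proof.
move=> mf f0; rewrite ge0_integral_EFin_density//.
have mH : measurable_fun [set: T] (fun x => `|G x - 1|)%R.
  by apply: measurableT_comp => //; exact: measurable_funB.
have mHf : measurable_fun [set: T] (fun x => `|G x - 1| * f x)%R.
  exact: measurable_funM.
have Hf0 x : (0 <= `|G x - 1| * f x)%R by rewrite mulr_ge0.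
apply: (@le_trans _ _ (\int[mu]_x (f x + `|G x - 1| * f x)%:E)).
  apply: ge0_le_integral_EFin => //.
  - exact: measurable_funM.
  - exact: measurable_funD.
  - by move=> x; rewrite mulr_ge0.
  - by move=> x; have := ler_norm (G x - 1); have := f0 x; nra.
rewrite ge0_integral_EFinD// leeD2l// integral_sqr_density.
rewrite (addeC 1) addeK//.
have sqrE : \int[mu]_x (f x ^+ 2)%:E = \int[mu]_x (f x `^ 2)%:E.
  by apply: eq_integral => x _; rewrite powR_mulrn.
rewrite sqrE.
apply: (@ge0_hoelder _ _ _ mu (fun x => `|G x - 1|)%R f 2%R 2%R) => //; lra.
Qed.

Lemma divergence_inequality f (q : R) : measurable_fun [set: T] f ->
  (forall x, 0 <= f x)%R -> (1 < q)%R ->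
  \int[nu]_x (f x)%:E <=
    (\int[mu]_x (G x `^ (q / (q - 1)))%:E) `^ (1 - q^-1) *
    (\int[mu]_x (f x `^ q)%:E) `^ q^-1.
Proof.
move=> mf f0 q1; rewrite ge0_integral_EFin_density//.
have q0 : (0 < q)%R by rewrite (lt_trans _ q1).
have q10 : (0 < q - 1)%R by rewrite subr_gt0.
have -> : (1 - q^-1 = (q / (q - 1))^-1)%R by field; rewrite !gt_eqF.
have -> : \int[mu]_x (f x * G x)%:E = \int[mu]_x (G x * f x)%:E.
  by apply: eq_integral => x _; rewrite mulrC.
apply: ge0_hoelder => //; first by rewrite divr_gt0.
by field; rewrite !gt_eqF.
Qed.

(** This is Jensen's inequality for the concave power [z ^ t] under the probability [nu], since
    [G ^ (1 + t)] is [G ^ t] times the density. *)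
Lemma integral_density_powR_le (t : R) : (0 < t <= 1)%R ->
  \int[mu]_x (G x `^ (1 + t))%:E <= (\int[mu]_x (G x ^+ 2)%:E) `^ t.
Proof.
move=> t01; have /andP[t0 t1] := t01.
(* A second moment of at least 1 gives a positive point at which to take the tangent. *)
have : 1 <= \int[mu]_x (G x ^+ 2)%:E.
  rewrite integral_sqr_density leeDl//; apply: integral_ge0 => x _.
  exact: powR_ge0.
case EM : (\int[mu]_x (G x ^+ 2)%:E) => [M||//] M1.
- have M0 : (0 < M)%R by rewrite -lte_fin (lt_le_trans _ M1).
  have m2 : measurable_fun [set: T] (fun x => G x ^+ 2)%R.
    exact: measurable_funX.
  apply: (@le_trans _ _ (\int[mu]_x
      (t * M `^ (t - 1) * G x ^+ 2 + (1 - t) * M `^ t * G x)%:E)).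
    apply: ge0_le_integral_EFin => //.
    + exact: (@measurableT_comp _ _ _ _ _ _ (fun z => z `^ (1 + t))%R).
    + by apply: measurable_funD; exact: measurable_funM.
    + by move=> x; exact: powR_ge0.
    + move=> x; rewrite -(@mulr_powRB1 _ _ (1 + t)%R)//; last first.
        by rewrite addr_gt0.
      rewrite (addrC 1%R) addrK.
      have := ler_wpM2l (G0 x) (powR_le_tangent (G0 x) M0 t01).
      move/le_trans; apply; rewrite le_eqVlt; apply/orP; left.
      by apply/eqP; ring.
  rewrite ge0_integral_EFinD//; last 4 first.
  + exact: measurable_funM.
  + exact: measurable_funM.
  + by move=> x; rewrite !mulr_ge0 ?sqr_ge0 ?powR_ge0// ltW.
  + by move=> x; rewrite !mulr_ge0 ?powR_ge0// subr_ge0.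
  under eq_integral do rewrite EFinM.
  rewrite ge0_integralZl_EFin//; last 3 first.
  + by move=> x _; rewrite lee_fin sqr_ge0.
  + exact/measurable_EFinP.
  + by rewrite mulr_ge0 ?powR_ge0// ltW.
  under [X in _ + X <= _]eq_integral do rewrite EFinM.
  rewrite ge0_integralZl_EFin//; last 3 first.
  + by move=> x _; rewrite lee_fin.
  + exact/measurable_EFinP.
  + by rewrite mulr_ge0 ?powR_ge0// subr_ge0.
  rewrite integral_density mule1 EM -EFinM -EFinD lee_fin -mulrA.
  rewrite (mulrC _ M) mulr_powRB1 ?(ltW M0)// -mulrDl.
  by rewrite addrC subrK mul1r.
(* With an infinite second moment the bound is [+oo], because [t] is positive. *)
- by rewrite poweRyr ?leey ?gt_eqF.
Qed.

Lemma pearson_power_inequality f (q : R) : measurable_fun [set: T] f ->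
  (forall x, 0 <= f x)%R -> (2 <= q)%R ->
  \int[nu]_x (f x)%:E <=
    (\int[mu]_x (G x ^+ 2)%:E) `^ q^-1 * (\int[mu]_x (f x `^ q)%:E) `^ q^-1.
Proof.
move=> mf f0 q2; have q1 : (1 < q)%R by rewrite (lt_le_trans _ q2)// ltr1n.
have q0 : (0 < q)%R by rewrite (lt_trans _ q1).
have q10 : (0 < q - 1)%R by rewrite subr_gt0.
apply: (le_trans (divergence_inequality mf f0 q1)).
apply: lee_wpmul2r; first exact: poweR_ge0.
(* With [t = 1 / (q - 1)], the conjugate exponent [q / (q - 1)] is [1 + t], and
   [t (1 - 1 / q) = 1 / q]. The assumption [2 <= q] enters below as [t <= 1]. *)
rewrite [X in _ <= _ `^ X](_ : _ = (q - 1)^-1 * (1 - q^-1))%R; last first.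
  by field; rewrite !gt_eqF.
rewrite poweRrM; apply: gt0_ler_poweR.
- by rewrite subr_ge0 invf_le1// ltW.
- rewrite in_itv/= leey andbT integral_ge0// => x _.
  by rewrite lee_fin powR_ge0.
- by rewrite in_itv/= leey andbT poweR_ge0.
have -> : (q / (q - 1) = 1 + (q - 1)^-1)%R by field; rewrite !gt_eqF.
apply: integral_density_powR_le; rewrite invr_gt0 q10/= invf_le1//; lra.
Qed.

(** The logarithm of [G] changes sign, so it is split into [lp - lm]. The integral of [lm] is
    finite, which makes it legitimate to integrate Young's inequality with [lm] on the left and to
    move it across only afterwards. *)
Lemma entropy_inequality f : measurable_fun [set: T] f ->
  (forall x, 0 <= f x)%R ->
  \int[nu]_x (f x)%:E <=
    \int[mu]_x (expR (f x))%:E - 1 + \int[nu]_x (ln (G x))%:E.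
Proof.
move=> mf f0; pose lp x : R := Num.max (ln (G x)) 0%R.
pose lm x : R := Num.max (- ln (G x))%R 0%R.
have mln : measurable_fun [set: T] (fun x => ln (G x)).
  exact: measurableT_comp.
have mlp : measurable_fun [set: T] lp by exact: measurable_maxr.
have mlm : measurable_fun [set: T] lm.
  by apply: measurable_maxr => //; exact: measurableT_comp.
have lp0 x : (0 <= lp x)%R by rewrite le_max lexx orbT.
have lm0 x : (0 <= lm x)%R by rewrite le_max lexx orbT.
have lB x : (ln (G x) = lp x - lm x)%R.
  rewrite /lp /lm; case: (leP (ln (G x)) 0%R) => h;
    by case: (leP (- ln (G x))%R 0%R) => h'; lra.
have mexp : measurable_fun [set: T] (fun x => expR (f x)).
  exact: measurableT_comp.
have lmG1 : \int[nu]_x (lm x)%:E <= 1.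
  rewrite ge0_integral_EFin_density// -(integral_probability_cst1 mu).
  apply: ge0_le_integral_EFin => //.
  - exact: measurable_funM.
  - by move=> x; rewrite mulr_ge0.
  (* Young's inequality at [a = 0] reads [- b ln b <= 1 - b], which bounds [lm G] by 1. *)
  - move=> x; have := mulr_le_expR 0%R (G0 x); rewrite expR0 /lm.
    have := G0 x.
    by case: (leP (- ln (G x))%R 0%R) => h; nra.
rewrite (integral_EFin_maxr nu (fun x => ln (G x))) -/lp -/lm.
have lm_fin : \int[nu]_x (lm x)%:E \is a fin_num.
  rewrite ge0_fin_numE ?(le_lt_trans lmG1) ?ltry// integral_ge0// => x _.
  by rewrite lee_fin.
(* Young's inequality without subtraction: [f G + G + lm G <= e^f + lp G]. The 1 on the left is the
   integral of [G]. *)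
have : \int[nu]_x (f x)%:E + (1 + \int[nu]_x (lm x)%:E) <=
    \int[mu]_x (expR (f x))%:E + \int[nu]_x (lp x)%:E.
  rewrite !ge0_integral_EFin_density// -integral_density.
  have mM (u : T -> R) : measurable_fun [set: T] u ->
      measurable_fun [set: T] (fun x => u x * G x)%R.
    by move=> mu0; exact: measurable_funM.
  have M0 (u : T -> R) : (forall x, 0 <= u x)%R -> forall x, (0 <= u x * G x)%R.
    by move=> u0 x; rewrite mulr_ge0.
  have mfG := mM _ mf; have mlmG := mM _ mlm; have mlpG := mM _ mlp.
  have fG0 := M0 _ f0; have lmG0 := M0 _ lm0; have lpG0 := M0 _ lp0.
  have m1 : measurable_fun [set: T] (fun x => G x + lm x * G x)%R.
    exact: measurable_funD.
  have h1 x : (0 <= G x + lm x * G x)%R by rewrite addr_ge0.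
  have e0 x : (0 <= expR (f x))%R by exact: expR_ge0.
  rewrite -!ge0_integral_EFinD//.
  apply: ge0_le_integral_EFin => //.
  - exact: measurable_funD.
  - exact: measurable_funD.
  - by move=> x; rewrite addr_ge0.
  - by move=> x; have := mulr_le_expR (f x) (G0 x); rewrite lB; lra.
move: lm_fin lmG1; case: (\int[nu]_x (lm x)%:E) => // b _ b1 h.
rewrite addeA leeBrDr// -EFinN -[leRHS]addeA (addeC (- 1)%:E) addeA.
by rewrite EFinN leeBrDr// -addeA (addeC _ 1).
Qed.
End change_of_measure.

(** * Boxes in tuple spaces, product measures and independence *)

Definition tuple_box (S : Type) n (B : 'I_n -> set S) : set (n.-tuple S) :=
  [set t | forall i, B i (tnth t i)].

Lemma tuple_box_bigcap (S : Type) n (B : 'I_n -> set S) :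
  tuple_box B = \bigcap_(i in [set: 'I_n]) ((@tnth n S)^~ i @^-1` B i).
Proof.
by apply/seteqP; split => [t Bt i _|t Bt i]; [exact: Bt|exact: (Bt i I)].
Qed.

Lemma measurable_tuple_box d (S : measurableType d) n (B : 'I_n -> set S) :
  (forall i, measurable (B i)) -> measurable (tuple_box B).
Proof.
move=> mB; rewrite tuple_box_bigcap.
apply: fin_bigcap_measurable => // i _.
rewrite -[X in measurable X]setTI; exact: measurable_tnth.
Qed.

Definition tuple_boxes d (S : measurableType d) n : set (set (n.-tuple S)) :=
  [set tuple_box B | B in [set B | forall i : 'I_n, measurable (B i)]].

Lemma measurable_tuple_boxes d (S : measurableType d) n :
  @measurable _ (n.-tuple S) = <<s @tuple_boxes d S n >>.
Proof.
apply/seteqP; split.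
- apply: smallest_sub; first exact: smallest_sigma_algebra.
  rewrite -bigcup_seq => A [/= i _ [B mB <-]]; apply: sub_sigma_algebra.
  (* A cylinder over one coordinate is a box whose other sides are the whole space. *)
  exists (fun j => if j == i then B else setT).
    by move=> j /=; case: ifP.
  rewrite setTI; apply/seteqP; split => t /=.
    by move=> /(_ i); rewrite eqxx.
  by move=> Bt j; case: eqP => // ->.
- apply: smallest_sub; first exact: sigma_algebra_measurable.
  by move=> A [B mB <-]; exact: measurable_tuple_box.
Qed.

Lemma setI_closed_tuple_boxes d (S : measurableType d) n :
  setI_closed (@tuple_boxes d S n).
Proof.
move=> _ _ [A mA <-] [B mB <-]; exists (fun i => A i `&` B i).
  by move=> i; exact: measurableI.
apply/seteqP; split => t /=.
  by move=> ABt; split => i; have [] := ABt i.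
by move=> [At Bt] i; split; [exact: At|exact: Bt].
Qed.

(** Uniqueness of measures on a generating pi-system: boxes are stable under intersection, generate
    the sigma-algebra and include the whole space, which has finite mass. *)
Lemma eq_measure_tuple_boxes d (S : measurableType d) (R : realType) n
    (m1 m2 : probability (n.-tuple S) R) :
  (forall B : 'I_n -> set S, (forall i, measurable (B i)) ->
    m1 (tuple_box B) = m2 (tuple_box B)) ->
  forall A, measurable A -> m1 A = m2 A.
Proof.
move=> m12; apply: (measure_unique (@tuple_boxes d S n) (fun=> setT)).
- exact: measurable_tuple_boxes.
- exact: setI_closed_tuple_boxes.
- by move=> _; exists (fun=> setT) => //; apply/seteqP; split.
- exact: bigcup_const.
- by move=> _ [B mB <-]; exact: m12.
- move=> _; apply: (@le_lt_trans _ _ 1); last exact: ltry.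
  exact: probability_le1.
Qed.

(** By induction on [n]: the preimage of a box under [tuple_cons] is the rectangle formed by its
    first side and the box of the remaining sides. *)
Lemma prod_probability_box (R : realType) n (mu : 'I_n -> probability R R)
    (B : 'I_n -> set R) : (forall i, measurable (B i)) ->
  prod_probability mu (tuple_box B) = \prod_(i < n) mu i (B i).
Proof.
elim: n mu B => [|n IHn] mu B mB /=.
  rewrite big_ord0 diracE mem_set//.
  by case.
rewrite big_ord_recl.
rewrite -(IHn (fun i => mu (lift ord0 i)) (fun i => B (lift ord0 i)))//.
rewrite -product_measure1E//; last exact: measurable_tuple_box.
rewrite /distribution /pushforward /=; congr (_ _).
apply/seteqP; split => -[x t] /=.
  move=> Bxt; split => [|i]; first exact: (Bxt ord0).
  by have := Bxt (lift ord0 i); rewrite tnthS.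
move=> [Bx Bt] i; case: (unliftP ord0 i) => [j|] ->; last by [].
by rewrite tnthS; exact: Bt.
Qed.

(** On boxes this is independence taken for the full index set [J]. *)
Lemma joint_law_independent d (T : measurableType d) (R : realType)
    (P : probability T R) n (X : 'I_n -> {RV P >-> R}) :
  mutually_independent X ->
  forall A, measurable A -> joint_law X A = product_law X A.
Proof.
move=> indX; apply: eq_measure_tuple_boxes => B mB.
rewrite [RHS]prod_probability_box//.
have := indX (finset.setTfor 'I_n) B (fun i _ => mB i).
under eq_bigl do rewrite inE; move=> <-.
rewrite /joint_law /distribution /pushforward /=; apply: (f_equal P).
apply/seteqP; split => w /=.
  by move=> Bw i _; have := Bw i; rewrite tnth_mktuple.
by move=> Bw i; rewrite tnth_mktuple; exact: (Bw i (finset.in_setT i)).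
Qed.

Lemma eq_product_law (R : realType) n
    d (T : measurableType d) (P : probability T R) (X : 'I_n -> {RV P >-> R})
    d' (T' : measurableType d') (P' : probability T' R)
    (xi : 'I_n -> {RV P' >-> R}) :
  same_marginals X xi ->
  forall A, measurable A -> product_law xi A = product_law X A.
Proof.
move=> Xxi; apply: eq_measure_tuple_boxes => B mB.
rewrite [LHS]prod_probability_box// [RHS]prod_probability_box//.
by apply: eq_bigr => i _; exact: Xxi.
Qed.

(** * The support of a probability on R^n is measurable and has full measure *)

Section support.
Context (R : realType) (n : nat) (mu : probability (n.-tuple R) R).

Let ball_box (x : n.-tuple R) (e : R) : set (n.-tuple R) :=
  [set y | forall i, (`|tnth x i - tnth y i| < e)%R].

Let measurable_ball_box x e : measurable (ball_box x e).
Proof.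
rewrite (_ : ball_box x e = tuple_box (fun i => ball (tnth x i) e))//.
by apply: measurable_tuple_box => i; exact: measurable_ball.
Qed.

Let rat_ball (p : n.-tuple rat * nat) : set (n.-tuple R) :=
  ball_box (map_tuple ratr p.1) p.2.+1%:R^-1.

(* [unpickle] enumerates the balls of rational centre and radius [1 / (m + 1)]. *)
Let null_rat_ball (k : nat) : set (n.-tuple R) :=
  if unpickle k is Some p then
    if mu (rat_ball p) == 0 then rat_ball p else set0
  else set0.

Let measurable_null_rat_ball k : measurable (null_rat_ball k).
Proof.
rewrite /null_rat_ball; case: unpickle => // p; case: ifP => // _.
exact: measurable_ball_box.
Qed.

Let null_null_rat_ball k : mu (null_rat_ball k) = 0.
Proof.
rewrite /null_rat_ball; case: unpickle => [p|]; last exact: measure0.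
by case: ifPn => [/eqP//|_]; exact: measure0.
Qed.

(** The Lindelöf argument: a point outside the support has a null ball around it, which contains a
    rational ball through the point; conversely, a null rational ball is open, so each of its points
    has a smaller null ball. *)
Let measure_supportC :
  ~` measure_support mu = \bigcup_k null_rat_ball k.
Proof.
apply/seteqP; split => x.
- move=> /existsNP[e /not_implyP[e0 /negP]]; rewrite -leNgt => xe.
  (* Half of [e] suffices for the radius: the rational centre is within one radius of [x], and the
     points of the rational ball are within one more. *)
  have [k ke] : exists k, (k.+1%:R^-1 < e / 2 :> R)%R.
    have e20 : (0 < e / 2)%R by rewrite divr_gt0.
    have [k _ /(_ k (leqnn _))] := near_infty_natSinv_lt (PosNum e20).
    by move=> ?; exists k.
  have qP (i : 'I_n) : {q : rat | `|ratr q - tnth x i| < (k.+1%:R^-1 : R)}%R.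
    have xk : (tnth x i - k.+1%:R^-1 < tnth x i + k.+1%:R^-1)%R.
      by rewrite ltrD2l gtrN// invr_gt0.
    apply: cid; have [q] := rat_in_itvoo xk; rewrite in_itv/= => /andP[q1 q2].
    by exists q; rewrite ltr_norml ltrBrDr addrC q1 ltrBlDl.
  pose p := ([tuple sval (qP i) | i < n], k).
  exists (pickle p) => //; rewrite /null_rat_ball pickleK ifT.
    by move=> i; rewrite tnth_map tnth_mktuple; exact: svalP (qP i).
  rewrite eq_le measure_ge0 andbT (le_trans _ xe)//.
  apply: le_measure; rewrite ?inE; [exact: measurable_ball_box..|].
  move=> y py i; have := py i; rewrite tnth_map tnth_mktuple /=.
  have := svalP (qP i) => /=; move: (sval (qP i)) => q qx qy.
  have -> : (tnth x i - tnth y i =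
      - (ratr q - tnth x i) + (ratr q - tnth y i))%R by ring.
  rewrite (le_lt_trans (ler_normD _ _))// normrN.
  by rewrite (splitr e) ltrD// (lt_trans _ ke).
- move=> [k _]; rewrite /null_rat_ball; case: unpickle => // p.
  case: ifPn => // /eqP p0 px xmu.
  pose g i := (p.2.+1%:R^-1 - `|ratr (tnth p.1 i) - tnth x i|)%R : R.
  (* The smallest distance left to the faces of the rational ball. The initial value 1 keeps [e]
     positive also when there is no coordinate. *)
  pose e := (\big[Num.min/1]_i g i)%R.
  have e0 : (0 < e)%R.
    apply: lt_bigmin => // i _; rewrite subr_gt0.
    by have := px i; rewrite tnth_map.
  have := xmu e e0; apply/negP; rewrite -leNgt -p0.
  apply: le_measure; rewrite ?inE; [exact: measurable_ball_box..|].
  move=> y yx i; rewrite tnth_map.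
  have ei : (e <= g i)%R by exact: bigmin_le_cond.
  have -> : (ratr (tnth p.1 i) - tnth y i =
      (ratr (tnth p.1 i) - tnth x i) + (tnth x i - tnth y i))%R by ring.
  rewrite (le_lt_trans (ler_normD _ _))// -ltrBrDl.
  exact: lt_le_trans (yx i) ei.
Qed.

Lemma measurable_support : measurable (measure_support mu).
Proof.
rewrite -[measure_support mu]setCK measure_supportC.
by apply: measurableC; exact: bigcupT_measurable.
Qed.

Lemma negligible_supportC : mu.-negligible (~` measure_support mu).
Proof.
rewrite measure_supportC; apply: negligible_bigcup => k.
exists (null_rat_ball k); split => //.
exact: null_null_rat_ball.
Qed.
End support.

(** * The dependence density, and expectations as integrals against the laws *)

Section dependence_density.
Context d (T : measurableType d) (R : realType) (P : probability T R).
Context n (X : 'I_n -> {RV P >-> R}).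
Context (ac : joint_law X `<< product_law X).

Local Notation RN :=
  (Radon_Nikodym_SigmaFinite.f (joint_law X) (product_law X)).

Let measurable_RN : measurable_fun [set: n.-tuple R] RN.
Proof. exact: measurable_int (Radon_Nikodym_SigmaFinite.f_integrable ac). Qed.

Lemma dependence_density_ge0 x : (0 <= dependence_density X x)%R.
Proof.
rewrite /dependence_density; case: ifP => // _.
by rewrite fine_ge0// Radon_Nikodym_SigmaFinite.f_ge0.
Qed.

Lemma measurable_dependence_density :
  measurable_fun [set: n.-tuple R] (dependence_density X).
Proof.
apply: measurable_fun_ifT => //.
- apply: (measurable_fun_bool true).
  rewrite setTI (_ : _ @^-1` _ = measure_support (product_law X)).
    exact: measurable_support.
  by apply/seteqP; split => x /=; [move/set_mem|move/mem_set].
- exact: measurableT_comp.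
Qed.

(** The two functions can differ only off the support, where the density is set to 1, and the
    complement of the support is negligible. *)
Lemma ae_eq_dependence_density :
  ae_eq (product_law X) [set: n.-tuple R]
    RN (fun x => (dependence_density X x)%:E).
Proof.
apply: (negligibleS _ (negligible_supportC (product_law X))) => x /= h xs.
apply: h => _; rewrite /dependence_density mem_set// fineK//.
exact: Radon_Nikodym_SigmaFinite.f_fin_num.
Qed.

(** Supplies the hypothesis [nuE] of the abstract inequalities. *)
Lemma integral_joint_law (h : n.-tuple R -> \bar R) :
  measurable_fun [set: n.-tuple R] h -> (forall x, 0 <= h x) ->
  \int[joint_law X]_x h x =
  \int[product_law X]_x (h x * (dependence_density X x)%:E).
Proof.
move=> mh h0.
rewrite -(Radon_Nikodym_SigmaFinite.change_of_variables ac)//.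
apply: ge0_ae_eq_integral => //.
- exact: emeasurable_funM.
- apply: emeasurable_funM => //; apply/measurable_EFinP.
  exact: measurable_dependence_density.
- by move=> x _; rewrite mule_ge0// Radon_Nikodym_SigmaFinite.f_ge0.
- by move=> x _; rewrite mule_ge0// lee_fin dependence_density_ge0.
- by apply: filterS ae_eq_dependence_density => x /= h' _; rewrite h'.
Qed.

Lemma expectation_random_vector (f : n.-tuple R -> R) :
  measurable_fun [set: n.-tuple R] f -> (forall x, 0 <= f x)%R ->
  'E_P[fun w => f (random_vector X w)] = \int[joint_law X]_x (f x)%:E.
Proof.
move=> mf f0; rewrite unlock ge0_integral_distribution//.
exact/measurable_EFinP.
Qed.

End dependence_density.

Section law_of_independent_copy.
Context (R : realType) (n : nat).
Context d (T : measurableType d) (P : probability T R).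
Context (X : 'I_n -> {RV P >-> R}).
Context d' (T' : measurableType d') (P' : probability T' R).
Context (xi : 'I_n -> {RV P' >-> R}).

(** By independence the joint law of [xi] is its product law, and equal marginals turn this into the
    product law of [X]. *)
Lemma expectation_independent_copy (f : n.-tuple R -> R) :
  mutually_independent xi -> same_marginals X xi ->
  measurable_fun [set: n.-tuple R] f -> (forall x, 0 <= f x)%R ->
  'E_P'[fun w => f (random_vector xi w)] = \int[product_law X]_x (f x)%:E.
Proof.
move=> ind same mf f0; rewrite expectation_random_vector//.
apply: eq_measure_integral => A mA _.
exact: etrans (joint_law_independent ind mA) (eq_product_law same mA).
Qed.

End law_of_independent_copy.

(** * Independent and constant vectors, for the cases of equality *)

Section independent.
Context (R : realType) (n : nat).
Context d (T : measurableType d) (P : probability T R).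
Context (X : 'I_n -> {RV P >-> R}).
Context (indX : mutually_independent X).

Lemma independent_dominates : joint_law X `<< product_law X.
Proof.
move=> A A0 B mB BA.
exact: etrans (joint_law_independent indX mB) (A0 B mB BA).
Qed.

(** Under independence the Radon-Nikodym derivative and the constant 1 have the same integral over
    every measurable set, so they agree almost everywhere and [ln G] vanishes almost everywhere. *)
Lemma relative_entropy_independent : relative_entropy X = 0.
Proof.
have ac := independent_dominates.
have RN1 : ae_eq (product_law X) [set: n.-tuple R]
    (Radon_Nikodym_SigmaFinite.f (joint_law X) (product_law X)) (cst 1).
  apply: integral_ae_eq => //.
    exact: Radon_Nikodym_SigmaFinite.f_integrable.
  move=> A _ mA; rewrite -Radon_Nikodym_SigmaFinite.f_integral//.
  rewrite integral_cst// mul1e; exact: joint_law_independent.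
rewrite /relative_entropy (eq_measure_integral (product_law X)); last first.
  by move=> A mA _; exact: joint_law_independent.
rewrite (ae_eq_integral (cst 0)) ?integral0//.
- apply/measurable_EFinP; apply: measurableT_comp => //.
  exact: measurable_dependence_density.
- move: RN1 (ae_eq_dependence_density ac); apply: filterS2 => x /= h1 h2 _.
  by have := h2 I; rewrite h1// => -[<-]; rewrite ln1.
Qed.

End independent.

(** Every event concerned is the full space or empty, so both sides are 1, or both are 0 as soon as
    one event is empty. *)
Lemma mutually_independent_cst d (T : measurableType d) (R : realType)
    (P : probability T R) n (c : 'I_n -> R) :
  mutually_independent (fun i => cst (c i) : {RV P >-> R}).
Proof.
move=> J A mA.
have preE i : cst (c i) @^-1` A i = [set _ : T | A i (c i)] by [].
have [cA|/existsNP[i /not_implyP[iJ ncA]]] :=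
    pselect (forall i, i \in J -> A i (c i)).
  rewrite (_ : \bigcap_(i in _) _ = setT); last first.
    by apply/seteqP; split => // w _ i /= iJ; exact: cA.
  rewrite probability_setT big1// => i iJ.
  rewrite (_ : _ @^-1` _ = setT) ?probability_setT//.
  by apply/seteqP; split => // w _; exact: cA.
rewrite (_ : \bigcap_(i in _) _ = set0); last first.
  by apply/seteqP; split => // w /(_ i iJ).
rewrite measure0 (bigD1 i)//= (_ : _ @^-1` _ = set0) ?measure0 ?mul0e//.
by apply/seteqP; split.
Qed.

(** * The four inequalities for random vectors, and their sharpness *)

Lemma decoupling_inequalities (R : realType) (n : nat)
    (d : measure_display) (T : measurableType d) (P : probability T R)
    (X : 'I_n -> {RV P >-> R})
    (d' : measure_display) (T' : measurableType d') (P' : probability T' R)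
    (xi : 'I_n -> {RV P' >-> R}) (f : n.-tuple R -> R) :
  decoupling_setting X xi f ->
  [/\ 'E_P[fun w => f (random_vector X w)]
        <= 'E_P'[fun w => f (random_vector xi w)]
           + pearson X
             * ('E_P'[fun w => (f (random_vector xi w) ^+ 2)%R]) `^ 2^-1,
      (forall q : R, (2 <= q)%R ->
        'E_P[fun w => f (random_vector X w)]
          <= (1 + pearson2 X) `^ q^-1
             * ('E_P'[fun w => (f (random_vector xi w) `^ q)%R]) `^ q^-1),
      'E_P[fun w => f (random_vector X w)]
        <= 'E_P'[fun w => expR (f (random_vector xi w))] - 1
           + relative_entropy X
    & (forall q : R, (1 < q)%R ->
        'E_P[fun w => f (random_vector X w)]
          <= (1 + divergence X (fun x => `|x| `^ (q / (q - 1)) - 1)%R)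
               `^ (1 - q^-1)
             * ('E_P'[fun w => (f (random_vector xi w) `^ q)%R]) `^ q^-1)].
Proof.
move=> [ac ind same mf f0].
have mG := measurable_dependence_density ac.
have G0 := dependence_density_ge0 ac.
have nuE := integral_joint_law ac.
have mpow q : measurable_fun [set: n.-tuple R] (fun x => f x `^ q)%R.
  exact: (@measurableT_comp _ _ _ _ _ _ (fun z => z `^ q)%R).
have EE (g : n.-tuple R -> R) :=
  @expectation_independent_copy R n _ _ _ X _ _ _ xi g ind same.
rewrite (expectation_random_vector X mf f0).
split.
- rewrite (EE f)// (EE (fun x => f x ^+ 2)%R); last 2 first.
  + exact: measurable_funX.
  + by move=> x; exact: sqr_ge0.
  exact: (pearson_inequality mG G0 nuE mf f0).
- move=> q q2; rewrite (EE (fun x => f x `^ q)%R)//; last first.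
    by move=> x; exact: powR_ge0.
  rewrite /pearson2 (addeC 1) subeK//.
  exact: (pearson_power_inequality mG G0 nuE mf f0 q2).
- rewrite (EE (fun x => expR (f x))); last 2 first.
  + exact: measurableT_comp.
  + by move=> x; exact: expR_ge0.
  exact: (entropy_inequality mG G0 nuE mf f0).
- move=> q q1; rewrite (EE (fun x => f x `^ q)%R)//; last first.
    by move=> x; exact: powR_ge0.
  rewrite /divergence add1_integralB1; last 2 first.
  + apply: (@measurableT_comp _ _ _ _ _ _
        (fun z => z `^ (q / (q - 1)))%R) => //.
    exact: measurableT_comp.
  + by move=> x; exact: powR_ge0.
  rewrite [X in _ <= X `^ _ * _](eq_integral
    (fun x => (dependence_density X x `^ (q / (q - 1)))%:E)); last first.
    by move=> x _; rewrite /= ger0_norm.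
  exact: (divergence_inequality mG G0 nuE mf f0 q1).
Qed.

(** A constant vector has independent coordinates, so it can serve as its own independent copy. *)
Lemma decoupling_setting_cst (R : realType) (n : nat) d (T : measurableType d)
    (P : probability T R) (c : 'I_n -> R) :
  let X i : {RV P >-> R} := cst (c i) in
  decoupling_setting X X (fun=> 0%R).
Proof.
move=> X; have indX : mutually_independent X by exact: mutually_independent_cst.
by split => //; exact: independent_dominates.
Qed.

Theorem theorem7p4 (R : realType) (n : nat) (n_gt0 : (0 < n)%N) :
  (* the four inequalities *)
  (forall (d : measure_display) (T : measurableType d) (P : probability T R)
      (X : 'I_n -> {RV P >-> R})
      (d' : measure_display) (T' : measurableType d') (P' : probability T' R)
      (xi : 'I_n -> {RV P' >-> R}) (f : n.-tuple R -> R),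
    decoupling_setting X xi f ->
    [/\ 'E_P[fun w => f (random_vector X w)]
          <= 'E_P'[fun w => f (random_vector xi w)]
             + pearson X
               * ('E_P'[fun w => (f (random_vector xi w) ^+ 2)%R]) `^ 2^-1,
        (forall q : R, (2 <= q)%R ->
          'E_P[fun w => f (random_vector X w)]
            <= (1 + pearson2 X) `^ q^-1
               * ('E_P'[fun w => (f (random_vector xi w) `^ q)%R]) `^ q^-1),
        'E_P[fun w => f (random_vector X w)]
          <= 'E_P'[fun w => expR (f (random_vector xi w))] - 1
             + relative_entropy X
      & (forall q : R, (1 < q)%R ->
          'E_P[fun w => f (random_vector X w)]
            <= (1 + divergence X (fun x => `|x| `^ (q / (q - 1)) - 1)%R)
                 `^ (1 - q^-1)
               * ('E_P'[fun w => (f (random_vector xi w) `^ q)%R]) `^ q^-1)])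
  /\
  (* sharpness of each of them *)
  [/\ (exists (d : measure_display) (T : measurableType d)
          (P : probability T R) (X : 'I_n -> {RV P >-> R})
          (d' : measure_display) (T' : measurableType d')
          (P' : probability T' R) (xi : 'I_n -> {RV P' >-> R})
          (f : n.-tuple R -> R),
        decoupling_setting X xi f /\
        'E_P[fun w => f (random_vector X w)]
          = 'E_P'[fun w => f (random_vector xi w)]
            + pearson X
              * ('E_P'[fun w => (f (random_vector xi w) ^+ 2)%R]) `^ 2^-1),
      (forall q : R, (2 <= q)%R ->
        exists (d : measure_display) (T : measurableType d)
          (P : probability T R) (X : 'I_n -> {RV P >-> R})
          (d' : measure_display) (T' : measurableType d')
          (P' : probability T' R) (xi : 'I_n -> {RV P' >-> R})
          (f : n.-tuple R -> R),
        decoupling_setting X xi f /\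
        'E_P[fun w => f (random_vector X w)]
          = (1 + pearson2 X) `^ q^-1
            * ('E_P'[fun w => (f (random_vector xi w) `^ q)%R]) `^ q^-1),
      (exists (d : measure_display) (T : measurableType d)
          (P : probability T R) (X : 'I_n -> {RV P >-> R})
          (d' : measure_display) (T' : measurableType d')
          (P' : probability T' R) (xi : 'I_n -> {RV P' >-> R})
          (f : n.-tuple R -> R),
        decoupling_setting X xi f /\
        'E_P[fun w => f (random_vector X w)]
          = 'E_P'[fun w => expR (f (random_vector xi w))] - 1
            + relative_entropy X)
    & (forall q : R, (1 < q)%R ->
        exists (d : measure_display) (T : measurableType d)
          (P : probability T R) (X : 'I_n -> {RV P >-> R})
          (d' : measure_display) (T' : measurableType d')
          (P' : probability T' R) (xi : 'I_n -> {RV P' >-> R})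
          (f : n.-tuple R -> R),
        decoupling_setting X xi f /\
        'E_P[fun w => f (random_vector X w)]
          = (1 + divergence X (fun x => `|x| `^ (q / (q - 1)) - 1)%R)
              `^ (1 - q^-1)
            * ('E_P'[fun w => (f (random_vector xi w) `^ q)%R]) `^ q^-1)].
Proof.
split; first exact: decoupling_inequalities.
(* One witness serves all four inequalities: the zero vector on a one-point space, with [f = 0]. *)
pose P : probability unit R := \d_tt.
pose X (i : 'I_n) : {RV P >-> R} := cst 0%R.
have settingP : decoupling_setting X X (fun=> 0%R).
  exact: decoupling_setting_cst.
have E0 (r : R) : r = 0%R -> 'E_P[fun=> r] = 0.
  by move=> ->; exact: expectation_cst.
split.
- exists _, unit, P, X, _, unit, P, X, (fun=> 0%R); split => //.
  (* The dependence coefficient is multiplied by 0, so by the convention [0 * +oo = 0] its value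
     need not be computed; likewise in the second and fourth cases. *)
  by rewrite !E0 ?expr0n// poweR0r ?invr_neq0// mule0 adde0.
- move=> q q2; exists _, unit, P, X, _, unit, P, X, (fun=> 0%R); split => //.
  have q0 : q != 0%R by rewrite gt_eqF// (lt_le_trans _ q2).
  by rewrite !E0 ?powR0// poweR0r ?invr_neq0// mule0.
- exists _, unit, P, X, _, unit, P, X, (fun=> 0%R); split => //.
  (* Here the entropy is added, not multiplied by 0, so it must be shown to vanish; the remaining
     term is [e^0 - 1 = 0]. *)
  have indX : mutually_independent X by exact: mutually_independent_cst.
  rewrite relative_entropy_independent// expR0 E0// adde0.
  by rewrite [X in X - _](expectation_cst P 1%R) subee.
- move=> q q1; exists _, unit, P, X, _, unit, P, X, (fun=> 0%R); split => //.
  have q0 : q != 0%R by rewrite gt_eqF// (lt_trans _ q1).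
  by rewrite !E0 ?powR0// poweR0r ?invr_neq0// mule0.
Qed.
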